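(* Let $(\mathfrak{L},[\cdot,\cdot],N)$ be a Nijenhuis Lie algebra over a field $K$, let $\mathfrak{S}\subseteq\mathfrak{L}$ be a Nijenhuis Lie subalgebra, and let $D\colon\mathfrak{S}\to\mathfrak{L}$ be a derivation of Nijenhuis Lie algebras defined on $\mathfrak{S}$. Let $N'H_D$ be the corresponding HNN-extension, i.e. the Nijenhuis Lie algebra (with operator $N'$) given by the presentation $$N'H_D=\bigl\langle \mathfrak{L},\,t \;\big|\; [t,a]=D(a),\ [t,N(a)]=D(N(a)),\ a\in\mathfrak{S}\bigr\rangle .$$ Then $\mathfrak{L}$ embeds into $N'H_D$: the canonical homomorphism of Nijenhuis Lie algebras $\mathfrak{L}\to N'H_D$ is injective.
   Context: Nijenhuis Lie algebra: a triple $(\mathfrak{L},[\cdot,\cdot],N)$ where $(\mathfrak{L},[\cdot,\cdot])$ is a Lie algebra over $K$ and $N\colon\mathfrak{L}\to\mathfrak{L}$ is a linear map with $$[N(x),N(y)]=N\bigl([N(x),y]+[x,N(y)]-N([x,y])\bigr)\quad\text{for all }x,y\in\mathfrak{L}.$$ A homomorphism of Nijenhuis Lie algebras is a Lie algebra homomorphism commuting with the operators. Nijenhuis Lie subalgebra: a subspace $\mathfrak{S}\subseteq\mathfrak{L}$ with $[x,y]\in\mathfrak{S}$ for all $x,y\in\mathfrak{S}$ and $N(\mathfrak{S})\subseteq\mathfrak{S}$. Derivation defined on $\mathfrak{S}$: a linear map $D\colon\mathfrak{S}\to\mathfrak{L}$ with $D([x,y])=[D(x),y]+[x,D(y)]$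 and $D(N(x))=N(D(x))$ for all $x,y\in\mathfrak{S}$. Presentation: $t$ is a new symbol not in $\mathfrak{L}$. The notation $\langle \mathfrak{L},t\mid\cdots\rangle$ means the Nijenhuis Lie algebra generated by $\mathfrak{L}$ and $t$, subject to all relations holding in $\mathfrak{L}$ (linear relations, brackets, and the values of $N$, so that the operator $N'$ of $N'H_D$ extends $N$) together with the listed relations. Equivalently, it is the universal Nijenhuis Lie algebra $H$ equipped with a homomorphism of Nijenhuis Lie algebras $\iota\colon\mathfrak{L}\to H$ and an element $t\in H$ satisfying $[t,\iota(a)]=\iota(D(a))$ and $[t,\iota(N(a))]=\iota(D(N(a)))$ for all $a\in\mathfrak{S}$: for any Nijenhuis Lie algebra $H'$ with a homomorphism $\iota'\colon\mathfrak{L}\to H'$ and an element $t'\in H'$ satisfying the same relations, there is a unique homomorphism $\varphi\colon H\to H'$ with $\varphi\circ\iota=\iota'$ and $\varphi(t)=t'$. The canonical homomorphism is $\iota$. *)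

(* Defs.v *)
From HB Require Import structures.
From mathcomp Require Import all_boot all_algebra.
From mathcomp Require Import boolp.

Set Implicit Arguments.
Unset Strict Implicit.
Unset Printing Implicit Defensive.

Import GRing.Theory.
Local Open Scope ring_scope.
Local Open Scope quotient_scope.

(* The bracket is alternating, not merely antisymmetric, so that the notion is
   the usual one in characteristic 2 as well. *)
HB.mixin Record isLieAlgebra (K : fieldType) L of GRing.Lmodule K L := {
  lie : L -> L -> L;
  lie_linearl : forall y, linear (fun x => lie x y);
  lie_linearr : forall x, linear (lie x);
  liexx : forall x, lie x x = 0;
  lie_jacobi : forall x y z,
    lie x (lie y z) + lie y (lie z x) + lie z (lie x y) = 0
}.

#[short(type="lieAlgType")]
HB.structure Definition LieAlgebra (K : fieldType) :=
  {L of GRing.Lmodule K L & isLieAlgebra K L}.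

HB.mixin Record isNijenhuis (K : fieldType) L of LieAlgebra K L := {
  nij : L -> L;
  nij_linear : linear nij;
  nijenhuis : forall x y : L,
    lie (nij x) (nij y) = nij (lie (nij x) y + lie x (nij y) - nij (lie x y))
}.

#[short(type="nijLieType")]
HB.structure Definition NijLie (K : fieldType) :=
  {L of LieAlgebra K L & isNijenhuis K L}.

HB.mixin Record isNijLieHom (K : fieldType) (L H : nijLieType K) (f : L -> H) :=
{
  hom_lie : forall x y, f (lie x y) = lie (f x) (f y);
  hom_nij : forall x, f (nij x) = nij (f x)
}.

#[short(type="nijLieHom")]
HB.structure Definition NijLieHom (K : fieldType) (L H : nijLieType K) :=
  {f of @GRing.Linear K L H *:%R f & isNijLieHom K L H f}.

HB.mixin Record isNijLieClosed (K : fieldType) (L : nijLieType K)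
    (S : {pred L}) := {
  lie_closed : {in S &, forall x y, lie x y \in S};
  nij_closed : {in S, forall x, nij x \in S}
}.

(* As in the library's [submodClosed], a subspace is a boolean predicate; since
   excluded middle is available this is no restriction. *)
#[short(type="nijSubalg")]
HB.structure Definition NijSubalg (K : fieldType) (L : nijLieType K) :=
  {S of @GRing.SubmodClosed K L S & isNijLieClosed K L S}.

Section Subalgebra.
Variables (K : fieldType) (L : nijLieType K) (S : nijSubalg L).

Record sub_nijLie : Type := SubNijLie { subval :> L; subvalP : subval \in S }.

HB.instance Definition _ := [isSub for subval].
HB.instance Definition _ := [Choice of sub_nijLie by <:].
HB.instance Definition _ := [SubChoice_isSubLmodule of sub_nijLie by <:].

Definition sub_lie (x y : sub_nijLie) : sub_nijLie :=
  SubNijLie (lie_closed _ _ (subvalP x) (subvalP y)).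

Definition sub_nij (x : sub_nijLie) : sub_nijLie :=
  SubNijLie (nij_closed _ (subvalP x)).

Lemma subval_inj : injective subval.
Proof. exact: val_inj. Qed.

Lemma subval_linear : linear subval.
Proof. exact: (linearP (val : sub_nijLie -> L)). Qed.

HB.instance Definition _ :=
  GRing.isLinear.Build K sub_nijLie L *:%R subval subval_linear.

Lemma subval_lie x y : subval (sub_lie x y) = lie (subval x) (subval y).
Proof. by []. Qed.

Lemma subval_nij x : subval (sub_nij x) = nij (subval x).
Proof. by []. Qed.

Lemma sub_lie_linearl y : linear (fun x => sub_lie x y).
Proof.
move=> a u v; apply/subval_inj.
by rewrite subval_linear !subval_lie subval_linear lie_linearl.
Qed.

Lemma sub_lie_linearr x : linear (sub_lie x).
Proof.
move=> a u v; apply/subval_inj.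
by rewrite subval_linear !subval_lie subval_linear lie_linearr.
Qed.

Lemma sub_liexx x : sub_lie x x = 0.
Proof. by apply/subval_inj; rewrite raddf0 subval_lie liexx. Qed.

Lemma sub_lie_jacobi x y z :
  sub_lie x (sub_lie y z) + sub_lie y (sub_lie z x) + sub_lie z (sub_lie x y)
  = 0.
Proof.
by apply/subval_inj; rewrite raddf0 !raddfD; exact: lie_jacobi.
Qed.

HB.instance Definition _ := isLieAlgebra.Build K sub_nijLie
  sub_lie_linearl sub_lie_linearr sub_liexx sub_lie_jacobi.

Lemma sub_nij_linear : linear sub_nij.
Proof.
move=> a u v; apply/subval_inj.
by rewrite subval_linear !subval_nij subval_linear nij_linear.
Qed.

Lemma sub_nijenhuis (x y : sub_nijLie) :
  lie (sub_nij x) (sub_nij y)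
  = sub_nij (lie (sub_nij x) y + lie x (sub_nij y) - sub_nij (lie x y)).
Proof.
apply/subval_inj; rewrite subval_nij raddfB raddfD; exact: nijenhuis.
Qed.

HB.instance Definition _ := isNijenhuis.Build K sub_nijLie
  sub_nij_linear sub_nijenhuis.

HB.instance Definition _ :=
  isNijLieHom.Build K sub_nijLie L subval subval_lie subval_nij.

Definition nij_derivation (D : {linear sub_nijLie -> L}) : Prop :=
  (forall x y : sub_nijLie,
     D (lie x y) = lie (D x) (subval y) + lie (subval x) (D y)) /\
  (forall x : sub_nijLie, D (nij x) = nij (D x)).

End Subalgebra.

Section Presentation.
Variables (K : fieldType) (X : Type).

Inductive nl_term : Type :=
| Tgen of X
| Tzero
| Topp of nl_term
| Tadd of nl_term & nl_term
| Tscale of K & nl_term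
| Tlie of nl_term & nl_term
| Tnij of nl_term.

HB.instance Definition _ := gen_eqMixin nl_term.
HB.instance Definition _ := gen_choiceMixin nl_term.

Variable R : nl_term -> nl_term -> Prop.

(* The least congruence on terms which contains the relations [R] and all the
   identities of Nijenhuis Lie algebras. *)
Inductive nl_cong : nl_term -> nl_term -> Prop :=
| cong_rel s t : R s t -> nl_cong s t
| cong_refl s : nl_cong s s
| cong_sym s t : nl_cong s t -> nl_cong t s
| cong_trans s t u : nl_cong s t -> nl_cong t u -> nl_cong s u
| cong_opp s s' : nl_cong s s' -> nl_cong (Topp s) (Topp s')
| cong_add s s' t t' :
    nl_cong s s' -> nl_cong t t' -> nl_cong (Tadd s t) (Tadd s' t')
| cong_scale a s s' : nl_cong s s' -> nl_cong (Tscale a s) (Tscale a s')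
| cong_lie s s' t t' :
    nl_cong s s' -> nl_cong t t' -> nl_cong (Tlie s t) (Tlie s' t')
| cong_nij s s' : nl_cong s s' -> nl_cong (Tnij s) (Tnij s')
| cong_addA s t u : nl_cong (Tadd s (Tadd t u)) (Tadd (Tadd s t) u)
| cong_addC s t : nl_cong (Tadd s t) (Tadd t s)
| cong_add0 s : nl_cong (Tadd Tzero s) s
| cong_addN s : nl_cong (Tadd (Topp s) s) Tzero
| cong_scaleA a b s : nl_cong (Tscale a (Tscale b s)) (Tscale (a * b) s)
| cong_scale1 s : nl_cong (Tscale 1 s) s
| cong_scaleDr a s t :
    nl_cong (Tscale a (Tadd s t)) (Tadd (Tscale a s) (Tscale a t))
| cong_scaleDl a b s :
    nl_cong (Tscale (a + b) s) (Tadd (Tscale a s) (Tscale b s))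
| cong_lie_linearl a s t u :
    nl_cong (Tlie (Tadd (Tscale a s) t) u)
            (Tadd (Tscale a (Tlie s u)) (Tlie t u))
| cong_lie_linearr a s t u :
    nl_cong (Tlie u (Tadd (Tscale a s) t))
            (Tadd (Tscale a (Tlie u s)) (Tlie u t))
| cong_liexx s : nl_cong (Tlie s s) Tzero
| cong_jacobi s t u :
    nl_cong (Tadd (Tadd (Tlie s (Tlie t u)) (Tlie t (Tlie u s)))
                  (Tlie u (Tlie s t))) Tzero
| cong_nij_linear a s t :
    nl_cong (Tnij (Tadd (Tscale a s) t)) (Tadd (Tscale a (Tnij s)) (Tnij t))
| cong_nijenhuis s t :
    nl_cong (Tlie (Tnij s) (Tnij t))
            (Tnij (Tadd (Tadd (Tlie (Tnij s) t) (Tlie s (Tnij t)))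
                        (Topp (Tnij (Tlie s t))))).

Definition nl_congb (s t : nl_term) : bool := `[< nl_cong s t >].

Lemma nl_congb_refl : reflexive nl_congb.
Proof. by move=> s; apply/asboolP; exact: cong_refl. Qed.

Lemma nl_congb_sym : symmetric nl_congb.
Proof. by move=> s t; apply/asboolP/asboolP => /cong_sym. Qed.

Lemma nl_congb_trans : transitive nl_congb.
Proof.
by move=> s t u /asboolP ts /asboolP su; apply/asboolP; apply: cong_trans ts su.
Qed.

Canonical nl_equiv := EquivRel nl_congb
  nl_congb_refl nl_congb_sym nl_congb_trans.

Definition presented := {eq_quot nl_equiv}.

HB.instance Definition _ := Choice.on presented.
HB.instance Definition _ := EqQuotient.on presented.

Definition pclass (s : nl_term) : presented := \pi s.

Lemma pclassP s t : pclass s = pclass t <-> nl_cong s t.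
Proof.
by split=> [/eqquotP/asboolP//|st]; apply/eqquotP/asboolP.
Qed.

Lemma pclass_repr s : nl_cong (repr (pclass s)) s.
Proof. by apply/pclassP; rewrite /pclass reprK. Qed.

Lemma pclassW (P : presented -> Prop) : (forall s, P (pclass s)) -> forall x, P x.
Proof. by move=> PS x; rewrite -[x]reprK; apply: PS. Qed.

Definition p0 : presented := pclass Tzero.
Definition popp (x : presented) : presented := pclass (Topp (repr x)).
Definition padd (x y : presented) : presented :=
  pclass (Tadd (repr x) (repr y)).
Definition pscale (a : K) (x : presented) : presented :=
  pclass (Tscale a (repr x)).
Definition plie (x y : presented) : presented :=
  pclass (Tlie (repr x) (repr y)).
Definition pnij (x : presented) : presented := pclass (Tnij (repr x)).

Lemma poppE s : popp (pclass s) = pclass (Topp s).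
Proof. by apply/pclassP/cong_opp/pclass_repr. Qed.
Lemma paddE s t : padd (pclass s) (pclass t) = pclass (Tadd s t).
Proof. by apply/pclassP/cong_add; apply: pclass_repr. Qed.
Lemma pscaleE a s : pscale a (pclass s) = pclass (Tscale a s).
Proof. by apply/pclassP/cong_scale/pclass_repr. Qed.
Lemma plieE s t : plie (pclass s) (pclass t) = pclass (Tlie s t).
Proof. by apply/pclassP/cong_lie; apply: pclass_repr. Qed.
Lemma pnijE s : pnij (pclass s) = pclass (Tnij s).
Proof. by apply/pclassP/cong_nij/pclass_repr. Qed.

Definition pE := (poppE, paddE, pscaleE, plieE, pnijE).

Lemma paddA : associative padd.
Proof.
elim/pclassW=> s; elim/pclassW=> t; elim/pclassW=> u.
by rewrite !pE; apply/pclassP; exact: cong_addA.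
Qed.

Lemma paddC : commutative padd.
Proof.
elim/pclassW=> s; elim/pclassW=> t.
by rewrite !pE; apply/pclassP; exact: cong_addC.
Qed.

Lemma padd0 : left_id p0 padd.
Proof. by elim/pclassW=> s; rewrite !pE; apply/pclassP; exact: cong_add0. Qed.

Lemma paddN : left_inverse p0 popp padd.
Proof. by elim/pclassW=> s; rewrite !pE; apply/pclassP; exact: cong_addN. Qed.

HB.instance Definition _ :=
  GRing.isZmodule.Build presented paddA paddC padd0 paddN.

Lemma pscaleA a b x : pscale a (pscale b x) = pscale (a * b) x.
Proof.
by elim/pclassW: x => s; rewrite !pE; apply/pclassP; exact: cong_scaleA.
Qed.

Lemma pscale1 : left_id 1 pscale.
Proof. by elim/pclassW=> s; rewrite !pE; apply/pclassP; exact: cong_scale1. Qed.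

Let pDE (x y : presented) : x + y = padd x y. Proof. by []. Qed.

Lemma pscaleDr : right_distributive pscale +%R.
Proof.
move=> a; elim/pclassW=> s; elim/pclassW=> t.
by rewrite !pDE !pE; apply/pclassP; exact: cong_scaleDr.
Qed.

Lemma pscaleDl x : {morph pscale^~ x : a b / a + b}.
Proof.
move=> a b; elim/pclassW: x => s.
by rewrite pDE !pE; apply/pclassP; exact: cong_scaleDl.
Qed.

HB.instance Definition _ := GRing.Zmodule_isLmodule.Build K presented
  pscaleA pscale1 pscaleDr pscaleDl.

Lemma pclass0 : pclass Tzero = 0. Proof. by []. Qed.
Lemma pclassN s : pclass (Topp s) = - pclass s.
Proof. by rewrite -poppE. Qed.
Lemma pclassD s t : pclass (Tadd s t) = pclass s + pclass t.
Proof. by rewrite -paddE. Qed.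
Lemma pclassZ a s : pclass (Tscale a s) = a *: pclass s.
Proof. by rewrite -pscaleE. Qed.

Lemma plie_linearl y : linear (fun x => plie x y).
Proof.
elim/pclassW: y => u a; elim/pclassW=> s; elim/pclassW=> t.
rewrite -pclassZ -pclassD !pE -pclassZ -pclassD.
by apply/pclassP; exact: cong_lie_linearl.
Qed.

Lemma plie_linearr x : linear (plie x).
Proof.
elim/pclassW: x => u a; elim/pclassW=> s; elim/pclassW=> t.
rewrite -pclassZ -pclassD !pE -pclassZ -pclassD.
by apply/pclassP; exact: cong_lie_linearr.
Qed.

Lemma pliexx x : plie x x = 0.
Proof.
by elim/pclassW: x => s; rewrite plieE -pclass0; apply/pclassP/cong_liexx.
Qed.

Lemma plie_jacobi x y z :
  plie x (plie y z) + plie y (plie z x) + plie z (plie x y) = 0.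
Proof.
elim/pclassW: x => s; elim/pclassW: y => t; elim/pclassW: z => u.
rewrite !plieE -!pclassD -pclass0.
by apply/pclassP; exact: cong_jacobi.
Qed.

HB.instance Definition _ := isLieAlgebra.Build K presented
  plie_linearl plie_linearr pliexx plie_jacobi.

Lemma pclass_lie s t : pclass (Tlie s t) = lie (pclass s) (pclass t).
Proof. by rewrite -plieE. Qed.

Lemma pnij_linear : linear pnij.
Proof.
move=> a; elim/pclassW=> s; elim/pclassW=> t.
rewrite -pclassZ -pclassD !pE -pclassZ -pclassD.
by apply/pclassP; exact: cong_nij_linear.
Qed.

Lemma pnijenhuis (x y : presented) :
  lie (pnij x) (pnij y)
  = pnij (lie (pnij x) y + lie x (pnij y) - pnij (lie x y)).
Proof.
elim/pclassW: x => s; elim/pclassW: y => t.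
rewrite (pnijE s) (pnijE t) -!pclass_lie (pnijE (Tlie s t)) -pclassN.
rewrite -(pclassD (Tlie (Tnij s) t)) -(pclassD (Tadd _ _)) (pnijE (Tadd _ _)).
by apply/pclassP; exact: cong_nijenhuis.
Qed.

HB.instance Definition _ := isNijenhuis.Build K presented
  pnij_linear pnijenhuis.

Lemma pclass_nij s : pclass (Tnij s) = nij (pclass s).
Proof. by rewrite -pnijE. Qed.

End Presentation.

Section HNN.
Variables (K : fieldType) (L : nijLieType K) (S : nijSubalg L).
Variable D : {linear sub_nijLie S -> L}.

Inductive hnn_gen : Type := BaseGen of L | StableGen.

Local Notation term := (nl_term K hnn_gen).
Local Notation base x := (Tgen K (BaseGen x) : term).
Local Notation stable := (Tgen K StableGen : term).

(* The first three relations are those which hold in [L]. The last one is an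
   instance of [hnn_stable], since [S] is closed under [nij]; it is kept because
   the presentation lists it. *)
Inductive hnn_rel : term -> term -> Prop :=
| hnn_base_linear (a : K) (x y : L) :
    hnn_rel (base (a *: x + y)) (Tadd (Tscale a (base x)) (base y))
| hnn_base_lie (x y : L) :
    hnn_rel (base (lie x y)) (Tlie (base x) (base y))
| hnn_base_nij (x : L) :
    hnn_rel (base (nij x)) (Tnij (base x))
| hnn_stable (x : sub_nijLie S) :
    hnn_rel (Tlie stable (base (subval x))) (base (D x))
| hnn_stable_nij (x : sub_nijLie S) :
    hnn_rel (Tlie stable (base (subval (nij x)))) (base (D (nij x))).

Definition hnn := presented hnn_rel.
HB.instance Definition _ := NijLie.on hnn.

Definition hnn_iota (x : L) : hnn := pclass hnn_rel (base x).
Definition hnn_t : hnn := pclass hnn_rel stable.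

Lemma hnn_iota_linear : linear hnn_iota.
Proof.
move=> a x y; rewrite /hnn_iota -pclassZ -pclassD.
exact/pclassP/cong_rel/hnn_base_linear.
Qed.

HB.instance Definition _ :=
  GRing.isLinear.Build K L hnn *:%R hnn_iota hnn_iota_linear.

Lemma hnn_iota_lie x y : hnn_iota (lie x y) = lie (hnn_iota x) (hnn_iota y).
Proof. by rewrite -pclass_lie; exact/pclassP/cong_rel/hnn_base_lie. Qed.

Lemma hnn_iota_nij x : hnn_iota (nij x) = nij (hnn_iota x).
Proof. by rewrite -pclass_nij; exact/pclassP/cong_rel/hnn_base_nij. Qed.

HB.instance Definition _ :=
  isNijLieHom.Build K L hnn hnn_iota hnn_iota_lie hnn_iota_nij.

Lemma hnn_tP (x : sub_nijLie S) :
  lie hnn_t (hnn_iota (subval x)) = hnn_iota (D x).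
Proof. by rewrite -pclass_lie; exact/pclassP/cong_rel/hnn_stable. Qed.

Lemma hnn_t_nijP (x : sub_nijLie S) :
  lie hnn_t (hnn_iota (subval (nij x))) = hnn_iota (D (nij x)).
Proof. by rewrite -pclass_lie; exact/pclassP/cong_rel/hnn_stable_nij. Qed.

(* The universal property of [hnn], with [hnn_iota] as the canonical
   homomorphism and [hnn_t] as the stable letter. *)
Section Universal.
Variables (H : nijLieType K) (j : nijLieHom L H) (u : H).
Hypothesis uP : forall x : sub_nijLie S, lie u (j (subval x)) = j (D x).

Fixpoint hnn_eval (s : term) : H :=
  match s with
  | Tgen (BaseGen x) => j x
  | Tgen StableGen => u
  | Tzero => 0
  | Topp s => - hnn_eval s
  | Tadd s t => hnn_eval s + hnn_eval t
  | Tscale a s => a *: hnn_eval s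
  | Tlie s t => lie (hnn_eval s) (hnn_eval t)
  | Tnij s => nij (hnn_eval s)
  end.

Lemma hnn_eval_cong s t : nl_cong hnn_rel s t -> hnn_eval s = hnn_eval t.
Proof.
elim=> {s t} /=; try by move=> *; congruence.
- move=> s t [a x y|x y|x|x|x] /=.
  + by rewrite linearP.
  + exact: hom_lie.
  + exact: hom_nij.
  + exact: uP.
  + exact (uP (nij x)).
- by move=> *; rewrite addrA.
- by move=> *; rewrite addrC.
- by move=> *; rewrite add0r.
- by move=> *; rewrite addNr.
- by move=> *; rewrite scalerA.
- by move=> *; rewrite scale1r.
- by move=> *; rewrite scalerDr.
- by move=> *; rewrite scalerDl.
- by move=> *; rewrite lie_linearl.
- by move=> *; rewrite lie_linearr.
- by move=> *; rewrite liexx.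
- by move=> *; rewrite lie_jacobi.
- by move=> *; rewrite nij_linear.
- by move=> *; rewrite nijenhuis.
Qed.

Definition hnn_lift (x : hnn) : H := hnn_eval (repr x).

Lemma hnn_liftE s : hnn_lift (pclass hnn_rel s) = hnn_eval s.
Proof. exact/hnn_eval_cong/pclass_repr. Qed.

Lemma hnn_lift_linear : linear hnn_lift.
Proof.
move=> a; elim/pclassW=> s; elim/pclassW=> t.
by rewrite -pclassZ -pclassD !hnn_liftE.
Qed.

HB.instance Definition _ :=
  GRing.isLinear.Build K hnn H *:%R hnn_lift hnn_lift_linear.

Lemma hnn_lift_lie x y : hnn_lift (lie x y) = lie (hnn_lift x) (hnn_lift y).
Proof.
elim/pclassW: x => s; elim/pclassW: y => t.
by rewrite -pclass_lie !hnn_liftE.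
Qed.

Lemma hnn_lift_nij x : hnn_lift (nij x) = nij (hnn_lift x).
Proof. by elim/pclassW: x => s; rewrite -pclass_nij !hnn_liftE. Qed.

HB.instance Definition _ :=
  isNijLieHom.Build K hnn H hnn_lift hnn_lift_lie hnn_lift_nij.

Lemma hnn_universal : exists phi : nijLieHom hnn H,
  [/\ forall x, phi (hnn_iota x) = j x, phi hnn_t = u
    & forall psi : nijLieHom hnn H,
        (forall x, psi (hnn_iota x) = j x) -> psi hnn_t = u -> psi =1 phi].
Proof.
exists (hnn_lift : nijLieHom hnn H); split=> [x||psi psij psiu].
- exact: hnn_liftE.
- exact: hnn_liftE.
elim/pclassW=> s /=; rewrite hnn_liftE; elim: s => /=.
- by case=> [x|]; [exact: psij | exact: psiu].
- exact: raddf0.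
- by move=> s IH; rewrite pclassN (raddfN psi) /= IH.
- by move=> s IHs t IHt; rewrite pclassD (raddfD psi) /= IHs IHt.
- by move=> a s IH; rewrite pclassZ linearZ /= IH.
- by move=> s IHs t IHt; rewrite pclass_lie hom_lie IHs IHt.
- by move=> s IH; rewrite pclass_nij hom_nij IH.
Qed.

End Universal.
End HNN.

(* Main.v *)
(* A Nijenhuis operator N on L extends to the formal vector fields on the formal
   group of L: left translations trivialise the tangent bundle, N is applied
   fibrewise, and its torsion is tensorial, so it vanishes because it vanishes on
   the left-invariant fields, which form a copy of L. A vector field is a linear
   map X : U(L) -> L, encoded below as a multilinear function of words in L with
   X(u x y v) - X(u y x v) = X(u [x,y] v). Bracketing X with the left-invariant
   field of s gives the map w |-> [X w, s] - X (w s), so the stable letter has to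
   be an X with X (w s) = [X w, s] - epsilon(w) D(s) for s in S. On U(S) this
   recursion has a unique solution vanishing at 1 because D is a derivation, and
   the Poincare-Birkhoff-Witt theorem, for an ordered basis of L whose elements
   in S come last, extends it by zero to U(L). *)
From HB Require Import structures.
From mathcomp Require Import all_boot all_algebra.
From mathcomp Require Import boolp functions wochoice.
Require Import Defs.

Set Implicit Arguments.
Unset Strict Implicit.
Unset Printing Implicit Defensive.

Import GRing.Theory.
Local Open Scope ring_scope.

(** * Equations in abelian groups *)

Inductive zexp := ZVar of nat | ZZero | ZOpp of zexp | ZAdd of zexp & zexp.

Fixpoint zeval (V : zmodType) (env : seq V) (t : zexp) : V :=
  match t with
  | ZVar i => env`_i
  | ZZero => 0
  | ZOpp s => - zeval env s
  | ZAdd s1 s2 => zeval env s1 + zeval env s2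
  end.

Fixpoint zcoef (t : zexp) (i : nat) : int :=
  match t with
  | ZVar j => if i == j then 1 else 0
  | ZZero => 0
  | ZOpp s => - zcoef s i
  | ZAdd s1 s2 => zcoef s1 i + zcoef s2 i
  end.

Lemma zevalE (V : zmodType) (env : seq V) (t : zexp) :
  zeval env t = \sum_(i < size env) env`_i *~ zcoef t i.
Proof.
elim: t => [j||s IH|s1 IH1 s2 IH2] /=.
- case: (ltnP j (size env)) => [lt_j|le_j].
    rewrite (bigD1 (Ordinal lt_j)) //= eqxx big1 ?addr0 // => i /eqP ne_ij.
    by case: eqP => // eq_ij; case: ne_ij; apply: val_inj.
  rewrite nth_default // big1 // => i _.
  by rewrite ltn_eqF // (leq_trans (ltn_ord i)).
- by rewrite big1.
- by rewrite IH -sumrN; apply: eq_bigr => i _; rewrite mulrNz.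
- by rewrite IH1 IH2 -big_split; apply: eq_bigr => i _; rewrite mulrzDr.
Qed.

(** An expression is the integer combination of its atoms with coefficients [zcoef], so comparing
    coefficients, a mere computation, suffices in every abelian group. *)
Lemma zeval_eq (V : zmodType) (env : seq V) (s t : zexp) :
  all (fun i => zcoef s i == zcoef t i) (iota 0 (size env)) ->
  zeval env s = zeval env t.
Proof.
move=> /allP eq_st; rewrite !zevalE; apply: eq_bigr => i _.
by rewrite (eqP (eq_st i _)) // mem_iota ltn_ord.
Qed.

(* Equal atoms may carry different paths to the same algebraic structure, so
   they are compared up to conversion. *)
Ltac zindex env x :=
  match env with
  | ?y :: _ => let _ := match goal with _ => unify x y end in constr:(O)
  | _ :: ?env' => let i := zindex env' x in constr:(S i)
  end.

Ltac zatoms env e :=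
  lazymatch e with
  | 0 => env
  | - ?a => zatoms env a
  | ?a + ?b => let env' := zatoms env a in zatoms env' b
  | _ => match env with
         | _ => let i := zindex env e in env
         | _ => constr:(e :: env)
         end
  end.

Ltac zreify env e :=
  lazymatch e with
  | 0 => constr:(ZZero)
  | - ?a => let s := zreify env a in constr:(ZOpp s)
  | ?a + ?b =>
      let s := zreify env a in let t := zreify env b in constr:(ZAdd s t)
  | _ => let i := zindex env e in constr:(ZVar i)
  end.

Ltac abelian :=
  lazymatch goal with
  | |- @eq ?V ?a ?b =>
      let env := zatoms (@nil V) a in
      let env := zatoms env b in
      let s := zreify env a in
      let t := zreify env b in
      exact (@zeval_eq _ env s t isT)
  end.

(** Deduces an equation from a known one [a = b]; the second premise is a formal identity, left to
    [abelian]. *)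
Lemma eq_from (V : zmodType) (x y a b : V) : a = b -> x - y = a - b -> x = y.
Proof. by move=> -> /eqP; rewrite subrr subr_eq0 => /eqP. Qed.

Lemma addr_eqs (V : zmodType) (a b a' b' : V) : a = b -> a' = b' -> a + a' = b + b'.
Proof. by move=> -> ->. Qed.

(** * The cost of insertion sort *)

Section Insertion.
Variables (B : eqType) (le : rel B).

Fixpoint ins (x : B) (m : seq B) : seq B :=
  if m is y :: m' then if le x y then x :: m else y :: ins x m' else [:: x].

Fixpoint isort (w : seq B) : seq B :=
  if w is x :: w' then ins x (isort w') else [::].

Lemma size_ins x m : size (ins x m) = (size m).+1.
Proof. by elim: m => //= y m IH; case: ifP => //= _; rewrite IH. Qed.

Lemma size_isort w : size (isort w) = size w.
Proof. by elim: w => //= x w IH; rewrite size_ins IH. Qed.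

Hypotheses (le_total : total le) (le_trans : transitive le)
  (le_anti : antisymmetric le).

Lemma ins_path y x m : le y x -> path le y m -> path le y (ins x m).
Proof.
elim: m y => [|z m IH] y /= le_yx; first by rewrite le_yx.
case/andP=> le_yz pzm; case: ifPn => [le_xz|nle_xz] /=.
  by rewrite le_yx le_xz.
by rewrite le_yz IH //; case/orP: (le_total x z) => // /(negP nle_xz).
Qed.

Lemma ins_sorted x m : sorted le m -> sorted le (ins x m).
Proof.
case: m => //= y m pym; case: ifPn => [le_xy|nle_xy] /=; first by rewrite le_xy.
by apply: ins_path => //; case/orP: (le_total x y) => // /(negP nle_xy).
Qed.

Lemma isort_sorted w : sorted le (isort w).
Proof. by elim: w => //= x w; apply: ins_sorted. Qed.

Lemma ins_id x m : sorted le (x :: m) -> ins x m = x :: m.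
Proof. by case: m => //= y m /andP[->]. Qed.

Lemma sorted_isort m : sorted le m -> isort m = m.
Proof.
elim: m => //= x m IH pxm; rewrite IH ?(path_sorted pxm) //; exact: ins_id.
Qed.

Lemma insC a b m : ins a (ins b m) = ins b (ins a m).
Proof.
wlog le_ab : a b / le a b.
  by move=> th; case/orP: (le_total a b) => /th.
have [->//|ne_ab] := eqVneq a b.
have nle_ba : le b a = false.
  by apply/negP => le_ba; case/eqP: ne_ab; apply: le_anti; rewrite le_ab.
elim: m => [|y m IH] /=; first by rewrite le_ab nle_ba.
case: (boolP (le b y)) => [le_by|nle_by] /=.
  by rewrite (le_trans le_ab le_by) /= le_ab nle_ba le_by.
case: (boolP (le a y)) => [le_ay|nle_ay] /=; last by rewrite (negPf nle_by) IH.
by rewrite nle_ba (negPf nle_by).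
Qed.

Lemma isort_cat u w1 w2 : isort w1 = isort w2 -> isort (u ++ w1) = isort (u ++ w2).
Proof. by move=> eq_w; elim: u => //= x u ->. Qed.

Lemma isort_swap u a b v : isort (u ++ a :: b :: v) = isort (u ++ b :: a :: v).
Proof. by apply: isort_cat => /=; apply: insC. Qed.

Section Cost.
Variables (E : zmodType) (c : seq B -> B -> B -> seq B -> E).

(** The letter [x] moves right through [m]; [p] is the whole word to its left, because the price of
    an exchange depends on its context. *)
Fixpoint ins_cost (p : seq B) (x : B) (m : seq B) : E :=
  if m is y :: m' then
    if le x y then 0 else c p x y m' + ins_cost (rcons p y) x m'
  else 0.

(* [c p x y m] is the price of turning p x y m into p y x m. The cost of sorting
   is a potential for c: exchanging two adjacent letters changes it by c. *)
Fixpoint sort_cost (p w : seq B) : E :=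
  if w is x :: w' then sort_cost (rcons p x) w' + ins_cost p x (isort w') else 0.

Lemma ins_cost_id p x m : sorted le (x :: m) -> ins_cost p x m = 0.
Proof. by case: m => //= y m /andP[->]. Qed.

Lemma sort_cost_id p m : sorted le m -> sort_cost p m = 0.
Proof.
elim: m p => //= x m IH p pxm.
rewrite IH ?(path_sorted pxm) // sorted_isort ?(path_sorted pxm) //.
by rewrite ins_cost_id ?addr0.
Qed.

Lemma sort_cost_cat p u w1 w2 : isort w1 = isort w2 ->
  sort_cost p (u ++ w1) - sort_cost p (u ++ w2)
  = sort_cost (p ++ u) w1 - sort_cost (p ++ u) w2.
Proof.
move=> eq_w; elim: u p => [|x u IH] p /=; first by rewrite cats0.
rewrite (isort_cat u eq_w) -cat_rcons -IH; abelian.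
Qed.

(* These are the consistency conditions along the loops made of exchanges: going
   back and forth, two disjoint exchanges, and the braid relation. *)
Hypothesis cN : forall u a b v, c u b a v = - c u a b v.
Hypothesis cxx : forall u a v, c u a a v = 0.
Hypothesis c_far : forall u a b p d e v,
  c (u ++ a :: b :: p) d e v - c (u ++ b :: a :: p) d e v
  = c u a b (p ++ d :: e :: v) - c u a b (p ++ e :: d :: v).
Hypothesis c_braid : forall u a b y v,
  c u a b (y :: v) + c (rcons u b) a y v + c u b y (a :: v)
  = c (rcons u a) b y v + c u a y (b :: v) + c (rcons u y) a b v.

(** The moving letter [x] never meets [a] and [b], so [c_far] applies to each of its exchanges, and
    the right-hand sides telescope. *)
Lemma ins_cost_far u a b p x m :
  ins_cost (u ++ a :: b :: p) x m - ins_cost (u ++ b :: a :: p) x m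
  = c u a b (p ++ x :: m) - c u a b (p ++ ins x m).
Proof.
elim: m p => [|y m IH] p /=; first by abelian.
case: ifP => _; first by abelian.
have e1 := c_far u a b p x y m; have e2 := IH (rcons p y).
rewrite !rcons_cat !rcons_cons !cat_rcons in e2 *.
apply: eq_from (addr_eqs e1 e2) _; abelian.
Qed.

Lemma sort_cost_far u a b p w :
  sort_cost (u ++ a :: b :: p) w - sort_cost (u ++ b :: a :: p) w
  = c u a b (p ++ w) - c u a b (p ++ isort w).
Proof.
elim: w p => [|x w IH] p /=; first by abelian.
have e1 := IH (rcons p x); have e2 := ins_cost_far u a b p x (isort w).
rewrite !rcons_cat !rcons_cons !cat_rcons in e1 *.
apply: eq_from (addr_eqs e1 e2) _; abelian.
Qed.

(** Both sides price a way of inserting [a] and [b] into [m]: exchange them first, or insert [b] and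
    then [a]. Where both letters pass some [y], the two ways differ by one braid relation and by
    exchanges in disjoint places. *)
Lemma ins_cost_braid u a b m :
  c u a b m + ins_cost (rcons u b) a m + ins_cost u b (ins a m)
  = ins_cost (rcons u a) b m + ins_cost u a (ins b m).
Proof.
wlog le_ab : a b / le a b.
  move=> th; case/orP: (le_total a b) => /th // e; apply: eq_from (esym e) _.
  rewrite (cN u a b); abelian.
have [<-|ne_ab] := eqVneq a b; first by rewrite cxx add0r.
have nle_ba : le b a = false.
  by apply/negP => le_ba; case/eqP: ne_ab; apply: le_anti; rewrite le_ab.
elim: m u => [|y m IH] u /=.
  by rewrite le_ab nle_ba (cN u a b); abelian.
case: (boolP (le b y)) => [le_by|nle_by] /=.
  by rewrite (le_trans le_ab le_by) /= le_ab nle_ba le_by (cN u a b); abelian.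
case: (boolP (le a y)) => [le_ay|nle_ay] /=.
  by rewrite nle_ba (negPf nle_by) (cN u a b); abelian.
rewrite (negPf nle_by).
have e1 := ins_cost_far u a y [::] b m; have e2 := ins_cost_far u b y [::] a m.
have e3 := IH (rcons u y); have e4 := c_braid u a b y m.
rewrite -!cats1 -!catA /= in e1 e2 e3 e4 *.
apply: eq_from (addr_eqs (addr_eqs e3 e4) (addr_eqs (esym e1) e2)) _; abelian.
Qed.

(** The prefix [u] cancels. Sorting [v] behind [a], [b] or behind [b], [a] is compared by
    [sort_cost_far], and the insertions into the sorted tail by [ins_cost_braid]. *)
Lemma sort_cost_swap u a b v :
  sort_cost [::] (u ++ a :: b :: v) - sort_cost [::] (u ++ b :: a :: v) = c u a b v.
Proof.
have e1 := ins_cost_braid u a b (isort v); have e2 := sort_cost_far u a b [::] v.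
rewrite sort_cost_cat /=; last exact: insC.
rewrite -!cats1 -!catA /= in e1 e2 *.
apply: eq_from (addr_eqs e2 (esym e1)) _; abelian.
Qed.

End Cost.
End Insertion.

(** * Straightening words *)

(** These are the linear maps on the tensor algebra of [V], given on pure tensors. *)
Definition multilinear (K : fieldType) (V E : lmodType K) (f : seq V -> E) :=
  forall u v, linear (fun x => f (u ++ x :: v)).

(** For multilinear [f] and [g = f] this says that [f] factors through the enveloping algebra. A
    separate [g] allows a construction by induction on the length of words. *)
Definition straightens (K : fieldType) (L : lieAlgType K) (E : lmodType K)
    (f g : seq L -> E) :=
  forall u v x y,
    f (u ++ x :: y :: v) - f (u ++ y :: x :: v) = g (u ++ lie x y :: v).

Section LinearFacts.
Variables (K : fieldType) (V W : lmodType K) (h : V -> W).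
Hypothesis h_lin : linear h.

Lemma linear_0 : h 0 = 0.
Proof. by have := h_lin (-1) 0 0; rewrite scaleN1r oppr0 addr0 scaleN1r addNr. Qed.

Lemma linear_D x y : h (x + y) = h x + h y.
Proof. by have := h_lin 1 x y; rewrite !scale1r. Qed.

Lemma linear_Z a x : h (a *: x) = a *: h x.
Proof. by have := h_lin a x 0; rewrite !addr0 linear_0 addr0. Qed.

Lemma linear_N x : h (- x) = - h x.
Proof. by rewrite -scaleN1r linear_Z scaleN1r. Qed.

Lemma linear_B x y : h (x - y) = h x - h y.
Proof. by rewrite linear_D linear_N. Qed.

End LinearFacts.

Section LieFacts.
Variables (K : fieldType) (L : lieAlgType K).
Implicit Types x y z : L.

Lemma lieDl x y z : lie (x + y) z = lie x z + lie y z.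
Proof. exact: (linear_D (lie_linearl z)). Qed.
Lemma lieNl x z : lie (- x) z = - lie x z.
Proof. exact: (linear_N (lie_linearl z)). Qed.
Lemma lie0l z : lie 0 z = 0 :> L.
Proof. exact: (linear_0 (lie_linearl z)). Qed.
Lemma lieDr x y z : lie z (x + y) = lie z x + lie z y.
Proof. exact: (linear_D (lie_linearr z)). Qed.
Lemma lieNr x z : lie z (- x) = - lie z x.
Proof. exact: (linear_N (lie_linearr z)). Qed.

Lemma lieC x y : lie x y = - lie y x.
Proof.
apply/eqP; rewrite -addr_eq0; apply/eqP.
by have := liexx (x + y); rewrite lieDl !lieDr !liexx add0r addr0.
Qed.

End LieFacts.

Section Straightening.
Variables (K : fieldType) (L : lieAlgType K) (E : lmodType K).
Variables (B : eqType) (le : rel B) (e : B -> L).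
Hypotheses (le_total : total le) (le_trans : transitive le)
  (le_anti : antisymmetric le).
Hypothesis e_span : forall h : L -> E,
  linear h -> (forall b, h (e b) = 0) -> forall x, h x = 0.
Implicit Types f g : seq L -> E.

Lemma multilinear_eq0 f w : multilinear f ->
  (forall u, size u = size w -> f (map e u) = 0) -> f w = 0.
Proof.
move=> f_lin; suff H p : (forall u, size u = size w -> f (map e (p ++ u)) = 0) ->
  f (map e p ++ w) = 0 by apply: (H [::]).
elim: w p => [|x w IH] p f0 /=; first by rewrite cats0 -[p]cats0 f0.
apply: (e_span (h := fun x => f (map e p ++ x :: w)) (f_lin _ _)) => b.
rewrite -cat_rcons -map_rcons IH // => u szu.
by rewrite cat_rcons f0 //= szu.
Qed.

(** The spanning half of the Poincare-Birkhoff-Witt theorem: each exchange made while sorting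
    changes [f] by its value at a shorter word, which vanishes by induction. *)
Lemma straightens_eq0 f : multilinear f -> straightens f f ->
  (forall m, sorted le m -> f (map e m) = 0) -> forall w, f w = 0.
Proof.
move=> f_lin f_str f0 w; have [n] := ubnP (size w).
elim: n w => // n IH w lt_wn; apply: multilinear_eq0 => // u szu.
have ins_inv p x m : size (p ++ x :: m) = size u ->
    f (map e (p ++ x :: m)) = f (map e (p ++ ins le x m)).
  elim: m p => [|y m IHm] p szp //=; case: ifP => // _.
  have := IHm (rcons p y); rewrite !cat_rcons => <-; last first.
    by rewrite -szp !size_cat.
  apply/eqP; rewrite -subr_eq0 !map_cat f_str; apply/eqP/IH.
  rewrite -ltnS (leq_trans _ lt_wn) // -szu -szp.
  by rewrite !size_cat /= !size_map !addnS ltnS.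
have sort_inv p v : size (p ++ v) = size u ->
    f (map e (p ++ v)) = f (map e (p ++ isort le v)).
  elim: v p => [|x v IHv] p szp //=.
  rewrite -cat_rcons IHv cat_rcons // ins_inv //.
  by rewrite -szp !size_cat /= size_isort.
by rewrite (sort_inv [::]) ?f0 //; apply: isort_sorted.
Qed.

(** Both sides are linear in every letter. The induction replaces the first letter of [u] by a basis
    vector and absorbs it into [f] and [g]. *)
Lemma straightens_basis f g : multilinear f -> multilinear g ->
  (forall u v a b, f (map e (u ++ a :: b :: v)) - f (map e (u ++ b :: a :: v))
     = g (map e u ++ lie (e a) (e b) :: map e v)) ->
  straightens f g.
Proof.
move=> f_lin g_lin fg u v x y; apply/eqP; rewrite -subr_eq0; apply/eqP.
elim: u f g f_lin g_lin fg x y => [|z u IH] f g f_lin g_lin fg x y.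
  move: x; apply: e_span => [a x1 x2|a] /=.
    rewrite (f_lin [::]) (f_lin [:: y]) lie_linearl (g_lin [::]) /=.
    rewrite !scalerDr !scalerN; abelian.
  move: y; apply: e_span => [b y1 y2|b] /=.
    rewrite (f_lin [::]) (f_lin [:: e a]) lie_linearr (g_lin [::]) /=.
    rewrite !scalerDr !scalerN; abelian.
  apply: (multilinear_eq0
    (f := fun v => f [:: e a, e b & v] - f [:: e b, e a & v]
                   - g (lie (e a) (e b) :: v))).
    move=> u v' k v1 v2.
    rewrite (f_lin [:: e a, e b & u]) (f_lin [:: e b, e a & u]).
    rewrite (g_lin (lie (e a) (e b) :: u)) /= !scalerDr !scalerN; abelian.
  by move=> w _; have := fg [::] w a b => /= ->; rewrite subrr.
move: z; apply: e_span => [k z1 z2|c] /=.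
  rewrite !(f_lin [::]) (g_lin [::]) /= !scalerDr !scalerN; abelian.
apply: (IH (fun w => f (e c :: w)) (fun w => g (e c :: w))).
- by move=> u' v'; apply: (f_lin (e c :: u')).
- by move=> u' v'; apply: (g_lin (e c :: u')).
by move=> u' v' a b; apply: (fg (c :: u')).
Qed.

(** * Existence in the Poincare-Birkhoff-Witt theorem *)

Variable ext : (B -> E) -> L -> E.
Hypothesis ext_lin : forall h, linear (ext h).
Hypothesis extE : forall h b, ext h (e b) = h b.

Lemma ext_linl k h1 h2 x :
  ext (fun b => k *: h1 b + h2 b) x = k *: ext h1 x + ext h2 x.
Proof.
apply/eqP; rewrite -subr_eq0; apply/eqP.
move: x; apply: e_span => [a x y|b] /=; last by rewrite !extE subrr.
rewrite !ext_lin !scalerDr scalerN !scalerDr (scalerA k) mulrC -(scalerA a).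
abelian.
Qed.

Fixpoint mext (h : seq B -> E) (w : seq L) : E :=
  if w is x :: w' then ext (fun b => mext (fun m => h (b :: m)) w') x else h [::].

Lemma mext_multilinear (h : seq B -> E) : multilinear (mext h).
Proof.
move=> u v; elim: u h => [|z u IH] h k x y /=; first exact: ext_lin.
by rewrite -ext_linl; congr (ext _ z); apply: funext => b; apply: IH.
Qed.

Lemma mextE (h : seq B -> E) m : mext h (map e m) = h m.
Proof. by elim: m h => //= b m IH h; rewrite extE IH. Qed.

Variable phi : seq B -> E.

Definition contraction g (u : seq B) (a b : B) (v : seq B) : E :=
  g (map e u ++ lie (e a) (e b) :: map e v).

(** The only possible multilinear [f] with [straightens f g] and values [phi] on sorted basis words:
    the exchanges made while sorting force its value on every basis word. *)
Definition straighten g : seq L -> E :=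
  mext (fun m => phi (isort le m) + sort_cost le (contraction g) [::] m).

Lemma straighten_sorted g m : sorted le m -> straighten g (map e m) = phi m.
Proof.
by move=> m_sorted; rewrite /straighten mextE sorted_isort // sort_cost_id // addr0.
Qed.

(** The prices [contraction f] are consistent: disjoint exchanges commute because both sides equal
    [g] at the word with both brackets formed, and the braid relation reduces to the Jacobi
    identity. *)
Lemma straighten_straightens f g : multilinear f -> multilinear g ->
  straightens f g -> straightens (straighten f) f.
Proof.
move=> f_lin g_lin fg; apply: straightens_basis => //.
  exact: mext_multilinear.
move=> u v a b; rewrite /straighten !mextE isort_swap //.
rewrite opprD addrACA subrr add0r.
apply: sort_cost_swap => // {u v a b} u a; rewrite /contraction.
- by move=> b v; rewrite lieC; exact: (linear_N (f_lin _ _)).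
- by move=> v; rewrite liexx; exact: (linear_0 (f_lin _ _)).
- move=> b p c d v; rewrite !map_cat /= -!catA /= fg.
  have := fg (map e u ++ lie (e a) (e b) :: map e p) (map e v) (e c) (e d).
  by rewrite -!catA /= => ->.
move=> b c v; rewrite !map_rcons -!cats1 -!catA /=.
move: (e a) (e b) (e c) (map e u) (map e v) => {u v a b c} x y z u v.
have e1 := fg u v (lie x y) z; have e3 := fg u v (lie y z) x.
have e2 := fg u v y (lie x z).
apply: eq_from (addr_eqs (addr_eqs e1 e2) e3) _.
rewrite [lie (lie x y) z]lieC [lie (lie y z) x]lieC [lie x z]lieC lieNr.
rewrite -!(linear_D (g_lin _ _)).
have -> : - lie z (lie x y) - lie y (lie z x) - lie x (lie y z) = 0.
  by apply: eq_from (esym (lie_jacobi x y z)) _; abelian.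
rewrite (linear_0 (g_lin _ _)); abelian.
Qed.

(* Meaningful on words of length n only, but by straightening with respect to the
   previous approximation on all words one needs no length bookkeeping. *)
Fixpoint pbw_approx (n : nat) : seq L -> E :=
  if n is n'.+1 then straighten (pbw_approx n') else straighten (fun=> 0).

(** A linear map on the enveloping algebra with arbitrary prescribed values [phi] on sorted basis
    words. *)
Definition pbw (w : seq L) : E := pbw_approx (size w) w.

Lemma pbw_sorted m : sorted le m -> pbw (map e m) = phi m.
Proof.
by move=> ?; rewrite /pbw; case: (size _) => [|n]; apply: straighten_sorted.
Qed.

Lemma pbw_approx_multilinear n : multilinear (pbw_approx n).
Proof. by case: n => [|n]; apply: mext_multilinear. Qed.

Lemma pbw_multilinear : multilinear pbw.
Proof.
by move=> u v k x y; rewrite /pbw !size_cat; apply: pbw_approx_multilinear.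
Qed.

Lemma pbw_approx_straightens n : straightens (pbw_approx n.+1) (pbw_approx n).
Proof.
have zero_lin : multilinear (fun _ : seq L => 0 : E).
  by move=> u v k x y; rewrite scaler0 addr0.
elim: n => [|n IH].
  apply: (straighten_straightens (g := fun=> 0)) => //.
    exact: mext_multilinear.
  by apply: (straighten_straightens (g := fun=> 0)) => // u v x y; rewrite subrr.
by apply: (straighten_straightens (g := pbw_approx n)) => //;
  [exact: (pbw_approx_multilinear n.+1) | exact: pbw_approx_multilinear].
Qed.

Lemma pbw_straightens : straightens pbw pbw.
Proof.
move=> u v x y; rewrite /pbw !size_cat /= !addnS.
exact: pbw_approx_straightens.
Qed.
End Straightening.

(** * Ordered bases *)

Section WellOrder.
Variables (T : eqType) (R : rel T).
Hypothesis R_wo : well_order R.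

Lemma wo_chainT : wo_chain R predT.
Proof. by move=> A _; apply: R_wo. Qed.

Lemma wo_total : total R.
Proof. by move=> x y; apply: (wo_chainW wo_chainT). Qed.

Lemma wo_anti : antisymmetric R.
Proof. by move=> x y; apply: (wo_chain_antisymmetric wo_chainT). Qed.

(** The least element of [[:: x; y; z]] decides: if it is [x] the claim is immediate, otherwise
    antisymmetry identifies two of the elements. *)
Lemma wo_trans : transitive R.
Proof.
move=> y x z Rxy Ryz.
have [] := R_wo (A := mem [:: x; y; z]); first by exists x; rewrite !inE eqxx.
move=> m [[]]; rewrite !inE => /or3P[]/eqP-> min_m _.
- by apply: min_m; rewrite !inE eqxx !orbT.
- have Ryx : R y x by apply: min_m; rewrite !inE eqxx.
  by rewrite (@wo_anti x y) // Rxy.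
have Rzy : R z y by apply: min_m; rewrite !inE eqxx orbT.
by rewrite -(@wo_anti y z) // Ryz.
Qed.

Lemma wo_ind (P : T -> Prop) :
  (forall x, (forall y, R y x -> y != x -> P y) -> P x) -> forall x, P x.
Proof.
move=> IH x; apply: contrapT => nPx.
have [] := R_wo (A := fun y => `[< ~ P y >]); first by exists x; apply/asboolP.
move=> m [[/asboolP nPm min_m] _]; apply: nPm; apply: IH => y Rym ne_ym.
apply: contrapT => nPy; case/eqP: ne_ym; apply: wo_anti.
by rewrite Rym min_m //; apply/asboolP.
Qed.

End WellOrder.

(** Members of [P] are put before all others, and each of the two classes keeps a given
    well-order. *)
Lemma well_order_initial (T : eqType) (P : {pred T}) :
  exists R : rel T, well_order R /\ forall x y, x \in P -> R y x -> y \in P.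
Proof.
have [R R_wo] := well_ordering_principle T.
exists (fun x y => if (x \in P) == (y \in P) then R x y else x \in P).
split=> [|x y Px]; last by rewrite Px; case: (y \in P).
apply: antisymmetric_well_order => [x y|A [x Ax]].
  rewrite [_ == (x \in P)]eq_sym; case: eqP => [_|]; first exact: wo_anti.
  by case: (x \in P) (y \in P) => [] [].
have [[y /andP[Ay Py]]|noP] := pselect (exists y, (y \in A) && (y \in P)).
  have [] := R_wo [predI A & P]; first by exists y; rewrite inE /= Ay.
  move=> m [[/andP[/= Am Pm] min_m] _]; exists m; split=> // z Az.
  rewrite Pm; case: ifP => // Pz; apply: min_m; rewrite inE /= Az.
  by rewrite -(eqP Pz).
have [] := R_wo A; first by exists x.
move=> m [[Am min_m] _]; exists m; split=> // z Az.
have nP w : w \in A -> (w \in P) = false.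
  by move=> Aw; apply/negP => Pw; apply: noP; exists w; rewrite Aw.
by rewrite !nP //=; apply: min_m.
Qed.

Section Span.
Variables (K : fieldType) (V : lmodType K).

Inductive spanned (A : V -> Prop) : V -> Prop :=
| spanned0 : spanned A 0
| spannedD a x y : A x -> spanned A y -> spanned A (a *: x + y).

Lemma spanned_lin (A : V -> Prop) a x y :
  spanned A x -> spanned A y -> spanned A (a *: x + y).
Proof.
move=> Ax Ay; elim: {x}Ax => [|b x z Ax _ IH]; first by rewrite scaler0 add0r.
by rewrite scalerDr scalerA -addrA; apply: spannedD.
Qed.

Lemma spanned_gen (A : V -> Prop) x : A x -> spanned A x.
Proof. by move=> Ax; rewrite -[x]addr0 -[x]scale1r; apply/spannedD/spanned0. Qed.

Lemma spanned_trans (A C : V -> Prop) x :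
  (forall y, A y -> spanned C y) -> spanned A x -> spanned C x.
Proof.
move=> AC; elim=> [|a y z Ay _ IH]; first exact: spanned0.
exact/spanned_lin/IH/AC.
Qed.

Lemma spanned_sum (A : V -> Prop) (k : V -> K) (s : seq V) :
  (forall x, x \in s -> A x) -> spanned A (\sum_(x <- s) k x *: x).
Proof.
elim: s => [|x s IH] As; first by rewrite big_nil; apply: spanned0.
rewrite big_cons; apply: spannedD; first by apply: As; rewrite mem_head.
by apply: IH => y ys; apply: As; rewrite inE ys orbT.
Qed.

End Span.

Section Basis.
Variables (K : fieldType) (V : lmodType K) (R : rel V).
Hypothesis R_wo : well_order R.

(* The leading elements form a basis adapted to every initial segment of R. *)
Definition leading (x : V) : Prop := ~ spanned (fun y => R y x /\ y != x) x.

Lemma leading_span x : spanned (fun y => leading y /\ R y x) x.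
Proof.
elim/(wo_ind R_wo): x => x IH.
have Rxx : R x x by have := wo_total R_wo x x; rewrite orbb.
have [lead_x|/contrapT] := pselect (leading x); first exact: spanned_gen.
apply: spanned_trans => y [Ryx ne_yx]; apply: spanned_trans (IH y Ryx ne_yx).
move=> z [lead_z Rzy]; apply: spanned_gen; split=> //.
exact: (wo_trans R_wo Rzy).
Qed.

(** With [s] sorted in decreasing order, a nonzero coefficient at its head would put this head into
    the span of smaller vectors. *)
Lemma leading_free (k : V -> K) (s : seq V) : uniq s ->
  (forall x, x \in s -> leading x) -> \sum_(x <- s) k x *: x = 0 ->
  forall x, x \in s -> k x = 0.
Proof.
pose r : rel V := fun x y => R y x.
have r_total : total r by move=> x y; apply: (wo_total R_wo).
have r_trans : transitive r by move=> x y z /= Rxy Rzx; exact: (wo_trans R_wo Rzx).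
rewrite -(sort_uniq r) => s_uniq s_lead.
rewrite -(perm_big _ (permEl (perm_sort r s))) /=.
have {s_lead} : forall x, x \in sort r s -> leading x.
  by move=> x; rewrite mem_sort; apply: s_lead.
move=> s_lead s0 x; rewrite -(mem_sort r).
have := sort_sorted r_total s; move: (sort r s) s_uniq s_lead s0 x => {}s.
elim: s => // x s IH /= /andP[nxs s_uniq] s_lead; rewrite big_cons => s0 y s_sorted.
have kx0 : k x = 0.
  apply: contrapT => /eqP kx; have [] := s_lead x (mem_head x s).
  have xE : x = - (k x)^-1 *: (\sum_(y <- s) k y *: y) + 0.
    move/eqP: s0; rewrite addr_eq0 => /eqP kxx.
    by rewrite addr0 scaleNr -scalerN -kxx scalerA mulVf // scale1r.
  rewrite [X in spanned _ X]xE; apply/spanned_lin/spanned0/spanned_sum => z zs.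
  split; last by apply: contraNneq nxs => <-.
  by have /allP/(_ z zs) := order_path_min r_trans s_sorted.
rewrite inE => /predU1P[-> //|ys].
apply: IH => //; first by move=> z zs; apply: s_lead; rewrite inE zs orbT.
- by move: s0; rewrite kx0 scale0r add0r.
exact: path_sorted s_sorted.
Qed.

Variables (E : lmodType K) (g : V -> E).

Definition graph (p : V * E) : Prop := leading p.1 /\ p.2 = g p.1.

Lemma sum_update (W : lmodType K) (G : V -> W) a k x (s : seq V) :
  x \in s -> uniq s ->
  \sum_(z <- s) (if z == x then a + k z else k z) *: G z
  = a *: G x + \sum_(z <- s) k z *: G z.
Proof.
move=> xs s_uniq; rewrite !(bigD1_seq x) //= eqxx scalerDl -addrA.
by congr (_ + (_ + _)); apply: eq_bigr => z /negPf ->.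
Qed.

Lemma graph_sum p : spanned graph p -> exists s (k : V -> K),
  [/\ uniq s, forall x, x \in s -> leading x,
      p.1 = \sum_(x <- s) k x *: x & p.2 = \sum_(x <- s) k x *: g x].
Proof.
elim=> [|a [x y] q [lead_x /= ->] _ [s [k [s_uniq s_lead -> ->]]]].
  by exists [::], (fun=> 0); rewrite !big_nil.
have [xs|nxs] := boolP (x \in s).
  exists s, (fun z => if z == x then a + k z else k z).
  by split; rewrite // sum_update.
exists (x :: s), (fun z => if z == x then a else k z).
rewrite /= nxs !big_cons eqxx; split=> //.
- by move=> z; rewrite inE => /predU1P[->|/s_lead].
- congr (_ + _); apply: eq_big_seq => z zs.
  by case: eqP nxs => // <-; rewrite zs.
congr (_ + _); apply: eq_big_seq => z zs.
by case: eqP nxs => // <-; rewrite zs.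
Qed.

(** The span of the graph of [g] over the leading vectors is again a graph: it is total because
    these vectors span, and single-valued because they are free. *)
Lemma leading_extend :
  exists h : V -> E, linear h /\ forall x, leading x -> h x = g x.
Proof.
have graph_total x : exists y, spanned graph (x, y).
  elim: (leading_span x) => [|a {}x y [lead_x _] _ [z yz]].
    by exists 0; apply: spanned0.
  by exists (a *: g x + z); apply: (spannedD a (x := (x, g x)) _ yz).
have graph_fun x y z : spanned graph (x, y) -> spanned graph (x, z) -> y = z.
  move=> xy xz; have := spanned_lin (-1) xy xz => /graph_sum[s [k [s_uniq s_lead]]].
  rewrite /= !scaleN1r addNr => /esym s0.
  rewrite big_seq big1 => [/eqP|w ws]; first by rewrite addrC subr_eq0 => /eqP.
  by rewrite (leading_free s_uniq s_lead s0 ws) scale0r.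
have [h hP] := choice graph_total; exists h; split=> [a x y|x lead_x].
  by apply: graph_fun (hP _) _; apply: (spanned_lin a (hP x) (hP y)).
by apply: graph_fun (hP x) _; apply: spanned_gen.
Qed.

End Basis.

Lemma ordered_basis (K : fieldType) (V : lmodType K) (S : {pred V}) :
  exists (B : eqType) (le : rel B) (e : B -> V),
  [/\ [/\ total le, transitive le & antisymmetric le],
      forall a b, e a \in S -> le a b -> e b \in S,
      forall x, spanned (fun y => exists2 b, y = e b & x \in S -> e b \in S) x
    & forall (E : lmodType K) (g : B -> E),
        exists h, linear h /\ forall b, h (e b) = g b].
Proof.
have [R [R_wo R_S]] := well_order_initial S.
(* [S] is initial for [R]; reversing the order makes its basis vectors come last in sorted words. *)
exists {x : V | `[< leading R x >]}, (fun a b => R (val b) (val a)), val.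
split=> [|a b Sa Rba|x|E g].
- split=> [a b|b a c Rba Rcb|a b /(wo_anti R_wo)/val_inj //].
    exact: wo_total.
  exact: (wo_trans R_wo Rcb).
- exact: R_S Rba.
- apply: spanned_trans (leading_span R_wo x) => y [/asboolP lead_y Ryx].
  by apply: spanned_gen; exists (Sub y lead_y) => // Sx; apply: R_S Ryx.
(* The value 0 outside the basis is junk: [hE] speaks of leading vectors only. *)
have [h [h_lin hE]] := leading_extend R_wo
  (fun x : V => if insub x is Some b then g b else 0).
exists h; split=> // b; rewrite hE ?valK //.
exact/asboolP/(valP b).
Qed.

(** * Formal vector fields *)

Section VectorFields.
Variables (K : fieldType) (L : nijLieType K).
Implicit Types f g h : seq L -> L.

Definition is_vfield f : Prop := multilinear f /\ straightens f f.

Definition vfield_pred : {pred seq L -> L} := fun f => `[< is_vfield f >].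

Lemma vfield_submod : submod_closed vfield_pred.
Proof.
split=> [|a f g /asboolP[f_lin f_str] /asboolP[g_lin g_str]]; apply/asboolP; split.
- by move=> u v k x y; rewrite /= scaler0 addr0.
- by move=> u v x y; rewrite subrr.
- move=> u v k x y; rewrite !fctE f_lin g_lin !scalerDr (scalerA a) mulrC -scalerA.
  abelian.
move=> u v x y; rewrite !fctE -f_str -g_str scalerDr scalerN; abelian.
Qed.

HB.instance Definition _ :=
  GRing.isSubmodClosed.Build K (seq L -> L) vfield_pred vfield_submod.

Record vfield : Type :=
  VField { vfield_fun :> seq L -> L; vfieldP : vfield_fun \in vfield_pred }.

HB.instance Definition _ := [isSub for vfield_fun].
HB.instance Definition _ := [Choice of vfield by <:].
HB.instance Definition _ := [SubChoice_isSubLmodule of vfield by <:].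

Implicit Types X Y Z : vfield.

Lemma vfield_multilinear X : multilinear X.
Proof. by have /asboolP[] := vfieldP X. Qed.

Lemma vfield_straightens X : straightens X X.
Proof. by have /asboolP[] := vfieldP X. Qed.

Lemma vfield_eq X Y : X =1 Y -> X = Y.
Proof. by move=> XY; apply/val_inj/funext. Qed.

Lemma vfieldD X Y w : (X + Y) w = X w + Y w. Proof. by []. Qed.
Lemma vfieldN X w : (- X) w = - X w. Proof. by []. Qed.
Lemma vfieldZ a X w : (a *: X) w = a *: X w. Proof. by []. Qed.

Lemma shift_subproof x X : (fun w => X (x :: w)) \in vfield_pred.
Proof.
apply/asboolP; split=> u v.
  exact: (vfield_multilinear X (x :: u)).
exact: (vfield_straightens X (x :: u)).
Qed.
Definition shift x X : vfield := VField (shift_subproof x X).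

Lemma shiftE x X w : shift x X w = X (x :: w). Proof. by []. Qed.

Lemma shift_linear x : linear (shift x).
Proof. by move=> a X Y; apply: vfield_eq. Qed.

Lemma shift_linearl a x y X : shift (a *: x + y) X = a *: shift x X + shift y X.
Proof. by apply: vfield_eq => w; apply: (vfield_multilinear X [::]). Qed.

Lemma shift_lie x y X :
  shift (lie x y) X = shift y (shift x X) - shift x (shift y X).
Proof. by apply: vfield_eq => w; rewrite -[LHS](vfield_straightens X [::]). Qed.

(* The empty word stands for evaluation at the origin, and [shift x], a
   right-invariant derivation, is a derivation of the bracket. *)
Fixpoint bracket X Y (w : seq L) : L :=
  if w is x :: w' then bracket (shift x X) Y w' + bracket X (shift x Y) w'
  else lie (X [::]) (Y [::]) + Y [:: X [::]] - X [:: Y [::]].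

Lemma bracket_nil X Y :
  bracket X Y [::] = lie (X [::]) (Y [::]) + Y [:: X [::]] - X [:: Y [::]].
Proof. by []. Qed.

Lemma bracket_cons X Y x w :
  bracket X Y (x :: w) = bracket (shift x X) Y w + bracket X (shift x Y) w.
Proof. by []. Qed.

Lemma vfield1_linear X : linear (fun x => X [:: x]).
Proof. exact: (vfield_multilinear X [::] [::]). Qed.

Lemma bracketC X Y w : bracket X Y w = - bracket Y X w.
Proof.
elim: w X Y => [|x w IH] X Y /=; first by rewrite lieC; abelian.
by rewrite IH (IH X) addrC opprD.
Qed.

Lemma bracket_linearl Y w : linear (fun X => bracket X Y w).
Proof.
move=> a X X'; elim: w X X' Y => [|x w IH] X X' Y.
  rewrite !bracket_nil !(vfieldD, vfieldZ) lie_linearl (vfield1_linear Y).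
  rewrite !scalerDr scalerN.
  abelian.
rewrite !bracket_cons shift_linear !IH scalerDr; abelian.
Qed.

Lemma bracket_linearr X w : linear (fun Y => bracket X Y w).
Proof.
move=> a Y Y'; rewrite !(bracketC X) bracket_linearl scalerN opprD; abelian.
Qed.

Lemma bracket_vfield X Y : bracket X Y \in vfield_pred.
Proof.
apply/asboolP; split=> u v.
  move=> a x y; elim: u X Y => [|z u IH] X Y; last first.
    rewrite !cat_cons !bracket_cons !IH !scalerDr; abelian.
  rewrite !cat0s !bracket_cons !shift_linearl bracket_linearl bracket_linearr.
  rewrite scalerDr; abelian.
move=> x y; elim: u X Y => [|z u IH] X Y; last first.
  rewrite !cat_cons !bracket_cons -!IH; abelian.
rewrite !cat0s !bracket_cons !shift_lie.
rewrite (linear_B (bracket_linearl _ _)) (linear_B (bracket_linearr _ _)); abelian.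
Qed.

Definition vfield_lie X Y : vfield := VField (bracket_vfield X Y).

Lemma vfield_lie0 X Y :
  vfield_lie X Y [::] = lie (X [::]) (Y [::]) + Y [:: X [::]] - X [:: Y [::]].
Proof. by []. Qed.

Lemma shift_vfield_lie x X Y :
  shift x (vfield_lie X Y) = vfield_lie (shift x X) Y + vfield_lie X (shift x Y).
Proof. exact: vfield_eq. Qed.

Lemma vfield_lie_linearl Y : linear (vfield_lie^~ Y).
Proof. by move=> a X X'; apply: vfield_eq => w; apply: bracket_linearl. Qed.

Lemma vfield_lie_linearr X : linear (vfield_lie X).
Proof. by move=> a Y Y'; apply: vfield_eq => w; apply: bracket_linearr. Qed.

Lemma vfield_liexx X : vfield_lie X X = 0.
Proof.
apply: vfield_eq => -[|x w]; first by rewrite vfield_lie0 liexx add0r subrr.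
by rewrite -[LHS]/(bracket _ _ _) bracket_cons (bracketC X) addrN.
Qed.

(** A field is determined by its iterated derivatives at the origin, and the Leibniz rule moves all
    derivatives of [F] onto its arguments. *)
Lemma vfield_eq0 (F : vfield -> vfield -> vfield -> vfield) :
  (forall X Y Z, F X Y Z [::] = 0) ->
  (forall X Y Z x, shift x (F X Y Z)
     = F (shift x X) Y Z + F X (shift x Y) Z + F X Y (shift x Z)) ->
  forall X Y Z, F X Y Z = 0.
Proof.
move=> F0 FS X Y Z; apply: vfield_eq => w; elim: w X Y Z => [|x w IH] X Y Z //.
by rewrite -shiftE FS !vfieldD !IH !addr0.
Qed.

Lemma vfield_lie_jacobi X Y Z :
  vfield_lie X (vfield_lie Y Z) + vfield_lie Y (vfield_lie Z X)
  + vfield_lie Z (vfield_lie X Y) = 0.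
Proof.
move: X Y Z; apply: vfield_eq0 => [X Y Z|X Y Z x].
  rewrite !vfieldD !vfield_lie0 -!shiftE !shift_vfield_lie !vfieldD.
  rewrite !vfield_lie0 !shiftE !(linear_D (vfield1_linear _)).
  rewrite !(linear_N (vfield1_linear _)) !lieDr !lieNr.
  (* Second derivatives at the origin commute up to a derivative along the bracket; this absorbs the
     terms not covered by the Jacobi identity of [L]. *)
  have e1 := vfield_straightens X [::] [::] (Y [::]) (Z [::]).
  have e2 := vfield_straightens Y [::] [::] (Z [::]) (X [::]).
  have e3 := vfield_straightens Z [::] [::] (X [::]) (Y [::]).
  rewrite /= in e1 e2 e3.
  rewrite (lieC (X [:: _])) (lieC (Y [:: _])) (lieC (Z [:: _])).
  apply: eq_from (addr_eqs (lie_jacobi (X [::]) (Y [::]) (Z [::]))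
    (addr_eqs e1 (addr_eqs e2 e3))) _; abelian.
rewrite !(linear_D (shift_linear _)) !shift_vfield_lie.
rewrite !(linear_D (vfield_lie_linearr _)); abelian.
Qed.

HB.instance Definition _ := isLieAlgebra.Build K vfield
  vfield_lie_linearl vfield_lie_linearr vfield_liexx vfield_lie_jacobi.

(** * The fibrewise operator and its torsion *)

Lemma nij_subproof X : (fun w => nij (X w)) \in vfield_pred.
Proof.
apply/asboolP; split=> u v.
  by move=> a x y; rewrite (vfield_multilinear X) nij_linear.
by move=> x y; rewrite -(linear_B nij_linear) (vfield_straightens X).
Qed.
Definition vfield_nij X : vfield := VField (nij_subproof X).

Lemma vfield_nij_linear : linear vfield_nij.
Proof. by move=> a X Y; apply: vfield_eq => w; apply: nij_linear. Qed.

Lemma shift_nij x X : shift x (vfield_nij X) = vfield_nij (shift x X).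
Proof. exact: vfield_eq. Qed.

Lemma vfield_nijE X w : vfield_nij X w = nij (X w). Proof. by []. Qed.

Definition torsion X Y : vfield :=
  vfield_lie (vfield_nij X) (vfield_nij Y)
  - vfield_nij (vfield_lie (vfield_nij X) Y + vfield_lie X (vfield_nij Y)
               - vfield_nij (vfield_lie X Y)).

(** All terms with derivatives of [X] and [Y] cancel, which leaves the torsion of [nij] on [L] at
    the values of the two fields. *)
Lemma torsion0 X Y : torsion X Y [::] = 0.
Proof.
rewrite /torsion vfieldD vfieldN vfield_nijE !vfieldD vfieldN vfield_nijE.
rewrite !vfield_lie0 !vfield_nijE.
rewrite nijenhuis !(linear_D nij_linear) !(linear_N nij_linear).
rewrite !(linear_D nij_linear) !(linear_N nij_linear); abelian.
Qed.

Lemma shift_torsion x X Y :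
  shift x (torsion X Y) = torsion (shift x X) Y + torsion X (shift x Y).
Proof.
rewrite /torsion !(linear_D (shift_linear _)) !(linear_N (shift_linear _)).
rewrite !(shift_nij, shift_vfield_lie) !(linear_D (shift_linear _)).
rewrite !(linear_N (shift_linear _)) !(shift_nij, shift_vfield_lie).
rewrite !(linear_D vfield_nij_linear) !(linear_N vfield_nij_linear).
rewrite !(linear_D vfield_nij_linear); abelian.
Qed.

Lemma torsion_eq0 X Y : torsion X Y = 0.
Proof.
apply: vfield_eq => w; elim: w X Y => [|x w IH] X Y; first exact: torsion0.
by rewrite -shiftE shift_torsion vfieldD !IH addr0.
Qed.

Lemma vfield_nijenhuis X Y :
  lie (vfield_nij X) (vfield_nij Y)
  = vfield_nij (lie (vfield_nij X) Y + lie X (vfield_nij Y) - vfield_nij (lie X Y)).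
Proof. by apply/eqP; rewrite -subr_eq0; apply/eqP/torsion_eq0. Qed.

HB.instance Definition _ := isNijenhuis.Build K vfield
  vfield_nij_linear vfield_nijenhuis.

Lemma constant_subproof (x : L) :
  (fun w : seq L => if w is [::] then x else 0) \in vfield_pred.
Proof.
apply/asboolP; split=> [u v a y z|u v y z]; case: u => //=;
  by rewrite ?scaler0 ?addr0 ?subrr.
Qed.
(** The left-invariant field with value [x] at the origin: it is constant in the left
    trivialisation, so its derivatives vanish. *)
Definition constant (x : L) : vfield := VField (constant_subproof x).

Lemma constant_linear : linear constant.
Proof.
move=> a x y; apply: vfield_eq => -[|z w]; rewrite vfieldD vfieldZ //=.
by rewrite scaler0 addr0.
Qed.

HB.instance Definition _ :=
  GRing.isLinear.Build K L vfield *:%R constant constant_linear.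

Lemma shift_constant z x : shift z (constant x) = 0.
Proof. exact: vfield_eq. Qed.

Lemma constant_lie x y : constant (lie x y) = lie (constant x) (constant y).
Proof.
apply: vfield_eq => -[|z w].
  by rewrite [RHS]vfield_lie0 /= addr0 subr0.
rewrite -[RHS]shiftE shift_vfield_lie !shift_constant.
rewrite (linear_0 (vfield_lie_linearl _)) (linear_0 (vfield_lie_linearr _)).
by rewrite addr0.
Qed.

Lemma constant_nij x : constant (nij x) = nij (constant x).
Proof. by apply: vfield_eq => -[|z w] //=; rewrite (linear_0 nij_linear). Qed.

HB.instance Definition _ :=
  isNijLieHom.Build K L vfield constant constant_lie constant_nij.

(** Each [shift] kills the constant field, so all letters of [w] go to [X] before the bracket is
    evaluated at the origin. *)
Lemma lie_constant X s w :
  vfield_lie X (constant s) w = lie (X w) s - X (rcons w s).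
Proof.
elim: w X => [|x w IH] X; first by rewrite vfield_lie0 addr0.
rewrite -shiftE shift_vfield_lie shift_constant.
by rewrite (linear_0 (vfield_lie_linearr _)) addr0; apply: IH.
Qed.

End VectorFields.

(** * The stable letter *)

Lemma linear_spanned0 (K : fieldType) (V W : lmodType K) (A : V -> Prop)
    (h : V -> W) x :
  linear h -> (forall y, A y -> h y = 0) -> spanned A x -> h x = 0.
Proof.
move=> h_lin hA; elim=> [|a y z /hA hy _ hz]; first exact: linear_0.
by rewrite h_lin hy hz scaler0 addr0.
Qed.

Section Cocycle.
Variables (K : fieldType) (L : nijLieType K) (S : nijSubalg L).
Variables (D : {linear sub_nijLie S -> L}).
Hypothesis D_lie : forall x y : sub_nijLie S,
  D (lie x y) = lie (D x) (subval y) + lie (subval x) (D y).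
Local Notation incl := (@subval K L S).
Implicit Types (l : L) (s : sub_nijLie S) (w : seq (sub_nijLie S)).

Definition act l w : L := foldl (fun l s => lie l (subval s)) l w.

(** The 1-cocycle on U(S) extending -D, for the right action [act] of [S] on [L]; [cocycle_rcons] is
    the recursion required of the stable letter. *)
Definition cocycle w : L := if w is s :: w' then act (- D s) w' else 0.

Lemma cocycle_rcons w s :
  cocycle (rcons w s) = lie (cocycle w) (subval s) - (if w is [::] then D s else 0).
Proof.
case: w => [|s' w] /=; first by rewrite lie0l add0r.
by rewrite /act foldl_rcons subr0.
Qed.

Lemma act_linear w : linear (act^~ w).
Proof.
by elim: w => //= s w IH a l l'; rewrite lie_linearl IH.
Qed.

Lemma act_multilinear l : multilinear (act l).
Proof.
move=> u v a x y; rewrite /act !foldl_cat /= -!/(act _ _).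
by rewrite lie_linearr act_linear.
Qed.

Lemma lie_jacobi_act l (x y : L) :
  lie (lie l x) y - lie (lie l y) x = lie l (lie x y).
Proof.
rewrite [lie (lie l x) y]lieC [lie (lie l y) x]lieC [lie l y]lieC lieNr.
apply: eq_from (congr1 -%R (lie_jacobi l x y)) _; abelian.
Qed.

Lemma act_straightens l : straightens (act l) (act l).
Proof.
move=> u v x y; rewrite /act !foldl_cat /= -!/(act _ _).
by rewrite -(linear_B (act_linear v)) lie_jacobi_act.
Qed.

Lemma cocycle_multilinear : multilinear cocycle.
Proof.
move=> [|z u] v a x y /=; last exact: act_multilinear.
by rewrite linearP opprD -scalerN act_linear.
Qed.

(** At the front of a word this is the derivation rule for [D]; further right it is the Jacobi
    identity. *)
Lemma cocycle_straightens : straightens cocycle cocycle.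
Proof.
move=> [|z u] v x y /=; last exact: act_straightens.
rewrite -!/(act _ _) -(linear_B (act_linear v)) D_lie; congr act.
rewrite !lieNl [lie (subval x) (D y)]lieC; abelian.
Qed.

End Cocycle.

(** * Extension by zero from U(S) to U(L) *)

Section Solution.
Variables (K : fieldType) (L : nijLieType K) (S : nijSubalg L).
Variables (D : {linear sub_nijLie S -> L}).
Hypothesis D_lie : forall x y : sub_nijLie S,
  D (lie x y) = lie (D x) (subval y) + lie (subval x) (D y).
Variables (B : eqType) (le : rel B) (e : B -> L).
Hypotheses (le_total : total le) (le_trans : transitive le)
  (le_anti : antisymmetric le).
Hypothesis le_S : forall a b, e a \in S -> le a b -> e b \in S.
Hypothesis e_span :
  forall x, spanned (fun y => exists2 b, y = e b & x \in S -> e b \in S) x.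
Variable t : seq L -> L.
Local Notation incl := (@subval K L S).
Hypotheses (t_lin : multilinear t) (t_str : straightens t t).

(* Junk value 0 when [e b] is not in S. *)
Definition proj_S (b : B) : sub_nijLie S := insubd (0 : sub_nijLie S) (e b).

Lemma proj_SE b : e b \in S -> subval (proj_S b) = e b.
Proof. by move=> Sb; rewrite -[LHS]/(val _) val_insubd Sb. Qed.

Hypothesis t_sorted : forall m, sorted le m -> t (map e m) =
  if all (fun b => e b \in S) m then cocycle D (map proj_S m) else 0.

Let e_spanL (h : L -> L) : linear h -> (forall b, h (e b) = 0) -> forall x, h x = 0.
Proof.
by move=> h_lin h0 x; apply: linear_spanned0 (e_span x) => // y [b ->].
Qed.

Let BS := {b : B | e b \in S}.
Let eS (b : BS) : sub_nijLie S := SubNijLie (valP b).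

Let eS_span (h : sub_nijLie S -> L) :
  linear h -> (forall b, h (eS b) = 0) -> forall s, h s = 0.
Proof.
move=> h_lin h0 s.
(* [h] is defined on [S] only, so the partial sums of an expansion of [s] are lifted to [S] one by
   one. *)
suff [s' /subval_inj -> //] : exists2 s', subval s' = subval s & h s' = 0.
elim: (e_span (subval s)) => [|a x y [b -> Sb] _ [s' <- hs']].
  by exists 0; [rewrite raddf0|rewrite linear_0].
exists (a *: eS (exist _ b (Sb (subvalP s))) + s'); first by rewrite subval_linear.
by rewrite h_lin h0 hs' scaler0 addr0.
Qed.

(** For fixed [p] both sides straighten in [w], so [w] may be taken sorted; then so is the whole
    word, and [t_sorted] applies. An unsorted [w] is allowed so that a letter of [S] can be appended
    later. *)
Lemma solution_split p w : sorted le p -> all (fun b => e b \notin S) p ->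
  t (map e p ++ map incl w) = if p is [::] then cocycle D w else 0.
Proof.
move=> p_sorted p_S; apply/eqP; rewrite -subr_eq0; apply/eqP.
move: w.
apply: (straightens_eq0 (le := fun a b : BS => le (val a) (val b)) (e := eS)).
- by move=> a b; apply: le_total.
- exact: eS_span.
- move=> u v a x y; rewrite !map_cat /= !catA t_lin.
  by case: p {p_sorted p_S} => [|b p]; rewrite ?cocycle_multilinear ?subr0 //
    !scalerDr !scalerN; abelian.
- move=> u v x y; rewrite !map_cat /= !catA -t_str.
  case: p {p_sorted p_S} => [|b p]; last by rewrite !subr0.
  by rewrite -(cocycle_straightens D_lie); abelian.
move=> m m_sorted.
have m_sortedB : sorted le (map val m) by rewrite sorted_map.
have m_S : all (fun b => e b \in S) (map val m).
  by rewrite all_map; apply/allP => b _; apply: (valP b).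
have -> : map incl (map eS m) = map e (map val m) by rewrite -!map_comp.
rewrite -map_cat t_sorted.
  rewrite all_cat m_S andbT; case: p p_sorted p_S => [|b p] _ /=.
    rewrite -map_comp (_ : map _ m = map eS m) ?subrr //; apply: eq_map => b /=.
    by apply: subval_inj; rewrite proj_SE //; apply: (valP b).
  by case/andP=> /negPf -> _; rewrite subr0.
(* Letters outside [S] precede those in [S] by [le_S], so the concatenation is sorted. *)
rewrite sorted_pairwise // pairwise_cat -!sorted_pairwise //.
rewrite p_sorted m_sortedB !andbT.
apply/allrelP => a b pa mb; case/orP: (le_total a b) => // le_ba.
by have := le_S (allP m_S b mb) le_ba; rewrite (negPf (allP p_S a pa)).
Qed.

Lemma sorted_split m : sorted le m -> exists p q,
  [/\ m = p ++ q, sorted le p, all (fun b => e b \notin S) p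
    & all (fun b => e b \in S) q].
Proof.
elim: m => [|b m IH] /=; first by exists [::], [::].
move=> pbm; have [Sb|nSb] := boolP (e b \in S).
  exists [::], (b :: m); split=> //=; rewrite Sb.
  apply/allP => c mc; apply: le_S Sb _.
  exact: (allP (order_path_min le_trans pbm)).
have [p [q [mE p_sorted p_S q_S]]] := IH (path_sorted pbm).
exists (b :: p), q; split=> //=; rewrite ?mE ?nSb //.
by move: pbm; rewrite mE cat_path => /andP[].
Qed.

(** By straightening, [w] may be taken sorted, with its letters in [S] last. Appending [s] preserves
    the shape treated by [solution_split], and the claim becomes the recursion for [cocycle]. *)
Lemma solution_rcons w (s : sub_nijLie S) :
  t (rcons w (subval s)) = lie (t w) (subval s) - (if w is [::] then D s else 0).
Proof.
apply/eqP; rewrite -subr_eq0; apply/eqP.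
move: w; apply: (straightens_eq0 (le := le) (e := e)) => //.
- move=> u v a x y; rewrite !rcons_cat !rcons_cons !t_lin lie_linearl.
  by case: u => [|z u] /=; rewrite !subr0 !scalerDr !scalerN; abelian.
- move=> u v x y; rewrite !rcons_cat !rcons_cons -!t_str lieDl lieNl.
  by case: u => [|z u] /=; abelian.
move=> m /sorted_split[p [q [-> p_sorted p_S q_S]]].
have qE : map e q = map incl (map proj_S q).
  by rewrite -map_comp; apply/eq_in_map => b /(allP q_S)/proj_SE.
rewrite map_cat qE rcons_cat -map_rcons !solution_split //.
case: p {p_sorted p_S} => [|b p] /=; last by rewrite lie0l; abelian.
rewrite cocycle_rcons; case: q {q_S qE} => [|b q] /=; abelian.
Qed.

End Solution.

(** The field [X] is the image of the stable letter in the Lie algebra of vector fields, with [L]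
    embedded as the constant fields. *)
Lemma derivation_inner (K : fieldType) (L : nijLieType K) (S : nijSubalg L)
    (D : {linear sub_nijLie S -> L}) :
  (forall x y : sub_nijLie S,
     D (lie x y) = lie (D x) (subval y) + lie (subval x) (D y)) ->
  exists X : vfield L, forall s, lie X (constant (subval s)) = constant (D s).
Proof.
move=> D_lie.
have [B [le [e [[le_total le_trans le_anti] le_S e_span e_ext]]]] :=
  ordered_basis (S : {pred L}).
have [ext /all_and2[ext_lin extE]] := choice (e_ext L).
have e_spanL (h : L -> L) :
    linear h -> (forall b, h (e b) = 0) -> forall x, h x = 0.
  by move=> h_lin h0 x; apply: linear_spanned0 (e_span x) => // y [b ->].
pose phi (m : seq B) : L :=
  if all (fun b => e b \in S) m then cocycle D (map (proj_S S e) m) else 0.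
pose t := pbw le e ext phi.
have t_lin : multilinear t by apply: pbw_multilinear.
have t_str : straightens t t by apply: pbw_straightens.
have t_sorted m : sorted le m -> t (map e m) = phi m by apply: pbw_sorted.
have t_vfield : t \in @vfield_pred K L by apply/asboolP.
exists (VField t_vfield) => s; apply: vfield_eq => w; rewrite [LHS]lie_constant /=.
rewrite (solution_rcons D_lie le_total le_trans le_S e_span t_lin t_str t_sorted).
by case: w => [|x w] /=; abelian.
Qed.

Theorem corollary5p1p1 (K : fieldType) (L : nijLieType K) (S : nijSubalg L)
    (D : {linear sub_nijLie S -> L}) (hD : nij_derivation D) :
  injective (hnn_iota D).
Proof.
have [X XD] := derivation_inner (proj1 hD).
pose j : nijLieHom L (vfield L) := @constant K L.
(* Elements identified in the extension have equal constant fields, and evaluation at the empty word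
   recovers the elements. *)
move=> x y /pclassP/(hnn_eval_cong (j := j) XD).
by move/(congr1 (fun Y : vfield L => Y [::])).
Qed.
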